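(* Fix a polynomial $\sigma$. There exist constants $c>0$ and $d_0\in\mathbb{N}$ (depending only on $\sigma$) such that the following holds. For each odd $d\in\mathbb{N}$ there exists a formulation of a nonempty polytope $P\subseteq[0,1]^d$, of size $f$, such that any formulation of $$\operatorname{conv}\big((P\cap\{x\in\mathbb{R}^d:x_d=0\})\cup(P\cap\{x\in\mathbb{R}^d:x_d=1\})\big)$$ of size at most $\sigma(f)$ has $\Omega(d)$ additional variables, i.e. has at least $c\,d$ additional variables whenever $d\ge d_0$.
   Context: For a set $X$, $\operatorname{conv}(X)$ is its convex hull. Given a polytope $P\subseteq\mathbb{R}^d$, a polytope $Q\subseteq\mathbb{R}^{d+m}$ (with $m\ge 0$) is a linear extension of $P$ with $m$ additional variables if $P=\operatorname{proj}_x(Q):=\{x\in\mathbb{R}^d:\exists\,y\in\mathbb{R}^m\text{ such that }(x,y)\in Q\}$; the case $Q=P$ ($m=0$) is allowed. A formulation of $P$ is a (finite) system of linear inequalities describing a linear extension $Q$ of $P$; its size is the number of inequalities in the system, and its number of additional variables is $m$. *)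

(* Defs.v *)
From mathcomp Require Import all_boot all_order all_algebra.
From mathcomp Require Import all_classical all_reals all_analysis.

Set Implicit Arguments.
Unset Strict Implicit.
Unset Printing Implicit Defensive.

Import Order.TTheory GRing.Theory Num.Theory.

Local Open Scope classical_set_scope.
Local Open Scope ring_scope.

Definition convex_hull (R : realType) (n : nat) (X : set 'cV[R]_n) :
    set 'cV[R]_n :=
  smallest (@convex_set R 'cV[R]_n) X.

(* The empty set is a polytope. *)
Definition polytope (R : realType) (n : nat) (P : set 'cV[R]_n) : Prop :=
  exists2 V : set 'cV[R]_n, finite_set V & P = convex_hull V.

Definition proj_x (R : realType) (d m : nat) (Q : set 'cV[R]_(d + m)) :
    set 'cV[R]_d :=
  [set x | exists y : 'cV[R]_m, Q (col_mx x y)].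

Definition linear_extension (R : realType) (d m : nat)
    (P : set 'cV[R]_d) (Q : set 'cV[R]_(d + m)) : Prop :=
  polytope Q /\ P = proj_x Q.

(* Solution set of the system A z <= b; its size is the number k of rows. *)
Definition solutions (R : realType) (k n : nat)
    (A : 'M[R]_(k, n)) (b : 'cV[R]_k) : set 'cV[R]_n :=
  [set z | forall i : 'I_k, (A *m z) i 0 <= b i 0].

(* A formulation of P of size k with m additional variables; the solution set
   is required to be a polytope, hence bounded. *)
Definition is_formulation (R : realType) (d m k : nat) (P : set 'cV[R]_d)
    (A : 'M[R]_(k, d + m)) (b : 'cV[R]_k) : Prop :=
  linear_extension P (solutions A b).

Definition unit_cube (R : realType) (d : nat) : set 'cV[R]_d :=
  [set x | forall i : 'I_d, 0 <= x i 0 <= 1].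

(* The dimension is written n.+1 so that ord_max indexes the last coordinate. *)
Definition last_slice (R : realType) (n : nat) (P : set 'cV[R]_n.+1) (t : R) :
    set 'cV[R]_n.+1 :=
  P `&` [set x | x ord_max 0 = t].

(* Main.v *)
Require Import Defs.
From mathcomp Require Import all_boot all_order all_algebra.
From mathcomp Require Import all_classical all_reals all_analysis.
From mathcomp Require Import ring lra zify.

Set Implicit Arguments.
Unset Strict Implicit.
Unset Printing Implicit Defensive.

Import Order.TTheory GRing.Theory Num.Theory.

Local Open Scope classical_set_scope.
Local Open Scope ring_scope.

(** Two polytopes with few facets can have a joint convex hull with very many:
    a facet of [conv (P0 * {0} \cup P1 * {1})] comes from a face of [P0] and a
    face of [P1] that share a normal direction, and the number of such pairs
    can be exponential in the dimension [2 * r + 1].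

    The slice [P0] at [t = 0] is a product of [r] polygons in the planes of
    [(x_i, y_i)], each bounded below by [N] chords of a parabola; the slice
    [P1] at [t = 1] has the simplex on the unit vectors of the [y_i] as a face.
    Choose one chord in each polygon, and scale its normal vector so that the
    coefficient of [y_i] is [1].  The sum of the [r] normals is orthogonal to a
    product of [r] edges of [P0], of dimension [r], and to that simplex, of
    dimension [r - 1]; these two faces span a facet.  Hence the hull has at
    least [N ^ r] facets, whereas [chord_polytope], which has these two slices,
    is described by about [r * N] inequalities.

    Conversely, by [facet_count], the projection of a polyhedron given by [k]
    inequalities and using [m] additional variables has at most
    [(k + 1) ^ (m + 1)] facets.  If [N] grows linearly with [r], a bound
    polynomial in the size of the formulation gives [k + 1 <= N ^ E] for a
    constant [E], and [N ^ r <= N ^ (E * (m + 1))] forces [m] to be linear in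
    [r].  The growth of [N] matters: with a fixed number of chords the count
    would only give [m] of the order of [r / ln r].

    That the solution set of the inequalities is the convex hull of finitely
    many points is [bounded_solutions_polytope]. *)

(** * Bounded polyhedra *)

Lemma row_mulmx_coef (R : pzSemiRingType) (k n : nat) (A : 'M[R]_(k, n))
    (z : 'cV[R]_n) (i : 'I_k) : (row i A *m z) 0 0 = (A *m z) i 0.
Proof. by rewrite -row_mul mxE. Qed.

Lemma mulmx_addZ_coef (R : realType) (k n : nat) (A : 'M[R]_(k, n))
    (z v : 'cV[R]_n) (t : R) (i : 'I_k) :
  (A *m (z + t *: v)) i 0 = (A *m z) i 0 + t * (A *m v) i 0.
Proof. by rewrite mulmxDr -scalemxAr !mxE. Qed.

Lemma convex_set_halfspace (R : realType) (n : nat) (w : 'rV[R]_n) (beta : R) :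
  @convex_set R 'cV[R]_n [set x | (w *m x) 0 0 <= beta].
Proof.
move=> x y l; rewrite !inE /= => hx hy.
rewrite /conv /= mulmxDr -!scalemxAr mxE [X in X + _]mxE [X in _ + X]mxE.
have l0 : 0 <= l%:num by [].
have l1 : l%:num <= 1 by [].
have -> : beta = l%:num * beta + (1 - l%:num) * beta.
  by rewrite -mulrDl addrC subrK mul1r.
by rewrite lerD // ler_wpM2l // subr_ge0.
Qed.

Lemma convex_hull_halfspace (R : realType) (n : nat) (V : set 'cV[R]_n)
    (w : 'rV[R]_n) (beta : R) :
  (forall x, V x -> (w *m x) 0 0 <= beta) ->
  forall x, convex_hull V x -> (w *m x) 0 0 <= beta.
Proof.
move=> Vw x; apply: (smallest_sub (@convex_set_halfspace R n w beta)) => y.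
exact: Vw.
Qed.

Lemma convex_hull_segment (R : realType) (n : nat) (V : set 'cV[R]_n)
    (z v : 'cV[R]_n) (s t : R) :
  0 < s -> 0 < t -> convex_hull V (z + t *: v) ->
  convex_hull V (z - s *: v) -> convex_hull V z.
Proof.
move=> s0 t0 h1 h2 C [cC VC].
have /mem_set z1 := h1 C (conj cC VC); have /mem_set z2 := h2 C (conj cC VC).
have st0 : 0 < s + t by rewrite addr_gt0.
have p0 : 0 <= s / (s + t) by rewrite divr_ge0 ?ltW.
have p1 : s / (s + t) <= 1 by rewrite ler_pdivrMr // mul1r lerDl ltW.
have /set_mem := cC _ _ (Itv01 p0 p1) z1 z2.
congr (C _); rewrite /conv /=; apply/matrixP => i j.
rewrite !mxE /unstable.onem.
by field; rewrite gt_eqF.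
Qed.

Definition tight (R : realType) (k n : nat) (A : 'M[R]_(k, n)) (b : 'cV[R]_k)
    (z : 'cV[R]_n) : {set 'I_k} :=
  [set i | (A *m z) i 0 == b i 0]%SET.

(** The tight inequalities stay tight along [v], and the others have slack, so
    some step is possible; the longest one is the smallest ratio of slack to
    speed, and it ends where a further inequality becomes tight. *)
Lemma feasible_step (R : realType) (k n : nat) (A : 'M[R]_(k, n))
    (b : 'cV[R]_k) (z v : 'cV[R]_n) :
  solutions A b z -> (forall i, i \in tight A b z -> (A *m v) i 0 = 0) ->
  exists t : R, [/\ 0 < t, solutions A b (z + t *: v) &
    (exists i, 0 < (A *m v) i 0) -> tight A b z \proper tight A b (z + t *: v)].
Proof.
move=> Sz vt.
case: (pselect (exists i, 0 < (A *m v) i 0)) => [[i0 vi0]|nv]; last first.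
  exists 1; split=> // i; rewrite mulmx_addZ_coef mul1r.
  have vi : (A *m v) i 0 <= 0.
    by rewrite leNgt; apply/negP => h; apply: nv; exists i.
  by have := Sz i; lra.
pose F i := (b i 0 - (A *m z) i 0) / (A *m v) i 0.
case: (@arg_minP _ _ _ i0 (fun i => 0 < (A *m v) i 0) F vi0) => i vi imin.
have ntight l : 0 < (A *m v) l 0 -> l \notin tight A b z.
  by move=> vl; apply/negP => /vt h; rewrite h ltxx in vl.
have slack l : 0 < (A *m v) l 0 -> (A *m z) l 0 < b l 0.
  by move/ntight; rewrite inE lt_neqAle Sz andbT.
have ti : (A *m z) i 0 + F i * (A *m v) i 0 = b i 0.
  by rewrite /F divfK ?gt_eqF // addrC subrK.
exists (F i); split.
- by rewrite divr_gt0 // subr_gt0 slack.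
- move=> l; rewrite mulmx_addZ_coef.
  have [vl|vl] := ltP 0 ((A *m v) l 0).
    by rewrite -lerBrDl -ler_pdivlMr //; exact: imin.
  apply: le_trans (Sz l); rewrite gerDl mulr_ge0_le0 //.
  by rewrite divr_ge0 // ?subr_ge0 ?Sz // ltW.
move=> _; apply/properP; split.
  apply/fintype.subsetP => l lt.
  rewrite inE mulmx_addZ_coef (vt _ lt) mulr0 addr0.
  by move: lt; rewrite inE.
by exists i; rewrite ?ntight // inE mulmx_addZ_coef ti.
Qed.

(** The half of the Minkowski-Weyl theorem that turns inequalities into
    vertices.  The generators are the feasible points at which the tight
    inequalities leave no direction free.  Such a point is determined by its
    set of tight inequalities, so there are finitely many.  Any other feasible
    point can be moved both ways along a free direction, gaining a tight
    inequality at both ends, and it lies between these two ends. *)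
Lemma bounded_solutions_polytope (R : realType) (k n : nat) (A : 'M[R]_(k, n))
    (b : 'cV[R]_k) (M : R) :
  (forall z, solutions A b z -> forall j, `|z j 0| <= M) ->
  polytope (solutions A b).
Proof.
move=> bdd.
pose V := [set z | solutions A b z /\ forall v : 'cV[R]_n,
  (forall i, i \in tight A b z -> (A *m v) i 0 = 0) -> v = 0].
have Vinj : {in V &, injective (tight A b)}.
  move=> z z'; rewrite !inE => -[_ Vz] [_ _] e.
  apply/eqP; rewrite -subr_eq0; apply/eqP; apply: Vz => i it.
  rewrite mulmxBr mxE [X in _ + X]mxE; apply/eqP; rewrite subr_eq0.
  by move: (it); rewrite e inE => /eqP ->; move: it; rewrite inE.
exists V.
  rewrite -(eq_finite_set (inj_card_eq Vinj)) //; exact: finite_finset.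
rewrite eqEsubset; split=> z; last first.
  move=> hz i; rewrite -row_mulmx_coef; apply: convex_hull_halfspace hz.
  by move=> x [Sx _]; rewrite row_mulmx_coef.
have [N] := ubnP #|~: tight A b z|; elim: N z => // N IH z zN Sz.
case: (pselect (forall v : 'cV[R]_n,
  (forall i, i \in tight A b z -> (A *m v) i 0 = 0) -> v = 0)) => [Vz|].
  by apply: sub_gen_smallest.
move=> /existsNP[v /not_implyP[vt /eqP v0]].
(* A nonzero direction along which no left-hand side increases would be a ray
   inside a bounded set. *)
have ray (u : 'cV[R]_n) : u != 0 -> exists i, 0 < (A *m u) i 0.
  move=> u0; apply: contrapT => nu.
  have ui i : (A *m u) i 0 <= 0.
    by rewrite leNgt; apply/negP => h; apply: nu; exists i.
  have [j uj] : exists j, u j 0 != 0.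
    apply: contrapT => h; move/eqP: u0; apply; apply/matrixP => j l.
    rewrite ord1 mxE; apply/eqP; apply: contrapT => /negP h'.
    by apply: h; exists j.
  have uj0 : 0 < `|u j 0| by rewrite normr_gt0.
  have zM := bdd _ Sz j.
  pose t := (M + 1 + `|z j 0|) / `|u j 0|.
  have t0 : 0 <= t by rewrite divr_ge0 //; have := normr_ge0 (z j 0); lra.
  have : solutions A b (z + t *: u).
    move=> i; rewrite mulmx_addZ_coef.
    have := Sz i; have : t * (A *m u) i 0 <= 0 by rewrite mulr_ge0_le0.
    by lra.
  move/bdd => /(_ j); rewrite !mxE => h.
  have := ler_normB (z j 0 + t * u j 0) (z j 0).
  rewrite [z j 0 + _]addrC addrK normrM (ger0_norm t0) /t divfK ?gt_eqF //.
  by rewrite [t * _ + _]addrC; lra.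
have closer (u : 'cV[R]_n) : u != 0 ->
    (forall i, i \in tight A b z -> (A *m u) i 0 = 0) ->
    exists2 t, 0 < t & convex_hull V (z + t *: u).
  move=> u0 ut; have [t [t0 St pt]] := feasible_step Sz ut.
  exists t => //; apply: IH St.
  apply: leq_trans (zN : (_ <= N)%N).
  by apply: proper_card; rewrite finset.properC; apply: pt; apply: ray.
have [t t0 ht] := closer v v0 vt.
have [||s s0 hs] := closer (- v); first by rewrite oppr_eq0.
  by move=> i it; rewrite mulmxN mxE vt ?oppr0.
by apply: (convex_hull_segment s0 t0 ht); rewrite -scalerN.
Qed.

(** * Facets of a projection *)

(** A subsystem of full rank has the same kernel, and it has as many rows as
    the rank.  Unused slots carry [None], so that one type of codes serves all
    ranks up to [q]. *)
Lemma kernel_of_few_rows (F : fieldType) (k N q : nat) (A : 'M[F]_(k, N))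
    (I : {set 'I_k}) :
  (\rank (\matrix_(i < k) (if i \in I then row i A else 0)%R) <= q)%N ->
  exists c : {ffun 'I_q -> option 'I_k}, forall v : 'cV[F]_N,
    (forall i, i \in I -> (A *m v) i 0 = 0) <->
    (forall a i, c a = Some i -> (A *m v) i 0 = 0).
Proof.
set M := \matrix_i _ => rq; pose h := maxrankfun M.
have Mv (v : 'cV[F]_N) i : (M *m v) i 0 = if i \in I then (A *m v) i 0 else 0.
  rewrite -(row_mulmx_coef M) rowK.
  by case: ifP => _; rewrite ?row_mulmx_coef // mul0mx mxE.
exists [ffun a : 'I_q => if insub (val a) is Some a' then
                    if h a' \in I then Some (h a') else None else None].
move=> v; split=> [vI a i|vc i iI].
  rewrite ffunE; case: insubP => // a' _ _.
  by case: ifP => // aI [<-]; apply: vI.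
have hv : rowsub h M *m v = 0.
  apply/matrixP => a j; rewrite ord1 [RHS]mxE.
  have -> : (rowsub h M *m v) a 0 = (M *m v) (h a) 0.
    by rewrite !mxE; apply: eq_bigr => l _; rewrite [in LHS]mxE.
  rewrite Mv; case: ifP => // aI.
  apply: (vc (widen_ord rq a)); rewrite ffunE insubT /=; first exact: ltn_ord.
  move=> lta; have -> : Sub (val a) lta = a by apply: val_inj.
  by rewrite aI.
have : (M <= rowsub h M)%MS by rewrite eq_maxrowsub.
case/submxP => D MD; have := Mv v i.
by rewrite iI MD -mulmxA hv mulmx0 mxE.
Qed.

(** Each facet of [Q] is the projection of a face of the polyhedron above it,
    and that face is cut out by turning some inequalities into equations.  The
    face has dimension at least [n], inside a space of dimension [n.+1 + m], so
    [m.+1] of these equations suffice, and there are at most [k.+1 ^ m.+1] ways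
    to choose them.  Here a facet is given by a valid inequality together with
    affinely independent points [p j] at which it is tight; the last hypothesis
    says that no two facets are parallel. *)
Lemma facet_count (R : realType) (n m k : nat) (A : 'M[R]_(k, n.+1 + m))
    (b : 'cV[R]_k) (Q : set 'cV[R]_n.+1) (J : finType) (w : J -> 'rV[R]_n.+1)
    (beta : J -> R) (p : J -> 'I_n.+1 -> 'cV[R]_n.+1) :
  Q = proj_x (solutions A b) ->
  (forall j x, Q x -> (w j *m x) 0 0 <= beta j) ->
  (forall j s, Q (p j s)) ->
  (forall j s, (w j *m p j s) 0 0 = beta j) ->
  (forall j, row_free
     (\matrix_(s < n) (p j (lift ord_max s) - p j ord_max)^T)) ->
  (forall j j', j != j' ->
     exists s, (w j *m p j' s) 0 0 != (w j *m p j' ord_max) 0 0) ->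
  (#|J| <= k.+1 ^ m.+1)%N.
Proof.
move=> QE wQ Qp wp pfree psep.
have {Qp} /choice[y yS] (j : J) : exists y : 'I_n.+1 -> 'cV[R]_m,
    forall s, solutions A b (col_mx (p j s) (y s)).
  have /choice[f fP] : forall s, exists u, solutions A b (col_mx (p j s) u).
    by move=> s; have := Qp j s; rewrite QE.
  by exists f.
pose z j s := col_mx (p j s) (y j s).
(* The barycentre lies in the relative interior of the face spanned by the
   lifted points: an inequality tight at it is tight at all of them. *)
pose g j := n.+1%:R^-1 *: \sum_s z j s.
have n1 : n.+1%:R != 0 :> R by rewrite pnatr_eq0.
have n1p : 0 <= n.+1%:R^-1 :> R by rewrite invr_ge0.
have Ag j i : b i 0 - (A *m g j) i 0 =
    n.+1%:R^-1 * \sum_s (b i 0 - (A *m z j s) i 0).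
  rewrite sumrB sumr_const card_ord -scalemxAr mulmx_sumr mxE summxE mulrBr.
  by congr (_ - _); rewrite -[X in _ * X]mulr_natl mulrA mulVf // mul1r.
have Sg j : solutions A b (g j).
  move=> i; rewrite -subr_ge0 Ag mulr_ge0 // sumr_ge0 // => s _.
  by rewrite subr_ge0; apply: yS.
have tz j i s : i \in tight A b (g j) -> (A *m z j s) i 0 = b i 0.
  rewrite inE => /eqP e; have /eqP := Ag j i.
  rewrite e subrr eq_sym mulf_eq0 invr_eq0 (negPf n1) /= => /eqP sum0.
  have : b i 0 - (A *m z j s) i 0 = 0.
    by apply: (psumr_eq0P _ sum0) => // l _; rewrite subr_ge0; apply: yS.
  by move/eqP; rewrite subr_eq0 => /eqP.
pose M j := \matrix_(i < k) (if i \in tight A b (g j) then row i A else 0).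
have rankM j : (\rank (M j) <= m.+1)%N.
  pose D := \matrix_(i < n.+1 + m, s < n)
    (z j (lift ord_max s) - z j ord_max) i 0.
  have AD i s : (A *m D) i s = (A *m (z j (lift ord_max s) - z j ord_max)) i 0.
    by rewrite [LHS]mxE [RHS]mxE; apply: eq_bigr => l _; rewrite [D _ _]mxE.
  have rD : \rank D = n.
    rewrite -mxrank_tr; apply/eqP; apply: inj_row_free => v vD.
    apply/eqP; rewrite -(mulmx_free_eq0 _ (pfree j)); apply/eqP.
    have -> : \matrix_(s < n) (p j (lift ord_max s) - p j ord_max)^T
              = (usubmx D)^T.
      by apply/matrixP => s i; rewrite !mxE !(unsplitK (inl _)).
    apply: trmx_inj; rewrite trmx_mul trmxK mul_usub_mx -[D]trmxK -trmx_mul vD.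
    by rewrite !trmx0 linear0.
  have : M j *m D = 0.
    apply/row_matrixP => i; rewrite row_mul rowK row0.
    case: ifP => [it|]; last by rewrite mul0mx.
    apply/rowP => s; rewrite -row_mul mxE AD mulmxBr mxE [X in _ + X]mxE.
    by rewrite !tz // subrr mxE.
  by move/mulmx0_rank_max; rewrite rD; lia.
have /choice[c cP] (j : J) := kernel_of_few_rows (rankM j).
(* Along the face of [j] both [v] and [- v] are feasible at [g j], so the
   inequality of [j], which is valid and tight there, does not change. *)
have wker j (v : 'cV[R]_(n.+1 + m)) :
    (forall i, i \in tight A b (g j) -> (A *m v) i 0 = 0) ->
    (w j *m usubmx v) 0 0 = 0.
  move=> vt.
  have wg : (w j *m usubmx (g j)) 0 0 = beta j.
    rewrite linearZ linear_sum -scalemxAr mulmx_sumr mxE summxE.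
    under eq_bigr do rewrite /z /= col_mxKu wp.
    by rewrite sumr_const card_ord -[X in _ * X]mulr_natl mulrA mulVf // mul1r.
  have le0 (u : 'cV[R]_(n.+1 + m)) :
      (forall i, i \in tight A b (g j) -> (A *m u) i 0 = 0) ->
      (w j *m usubmx u) 0 0 <= 0.
    move=> ut; have [t [t0 St _]] := feasible_step (Sg j) ut.
    have /(wQ j) : Q (usubmx (g j + t *: u)).
      by rewrite QE; exists (dsubmx (g j + t *: u)); rewrite vsubmxK.
    have -> : usubmx (g j + t *: u) = usubmx (g j) + t *: usubmx u.
      by apply/matrixP => i l; rewrite !mxE.
    by rewrite mulmx_addZ_coef wg gerDl pmulr_rle0.
  have wN : (w j *m usubmx (- v)) 0 0 = - (w j *m usubmx v) 0 0.
    have -> : usubmx (- v) = - usubmx v by apply/matrixP => i l; rewrite !mxE.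
    by rewrite mulmxN [LHS]mxE.
  apply/eqP; rewrite eq_le le0 //= -oppr_le0 -wN le0 // => i it.
  by rewrite mulmxN [LHS]mxE vt ?oppr0.
have cinj : injective c.
  move=> j j' e; apply/eqP; apply: contrapT => /negP /psep[s /eqP]; apply.
  have : (w j *m usubmx (z j' s - z j' ord_max)) 0 0 = 0.
    apply: wker; apply/cP; rewrite e; apply/cP => i it.
    by rewrite mulmxBr mxE [X in _ + X]mxE !tz ?subrr.
  rewrite linearB /= !col_mxKu mulmxBr mxE [X in _ + X]mxE => /eqP.
  by rewrite subr_eq0 => /eqP.
by have := leq_card _ cinj; rewrite card_ffun card_option !card_ord.
Qed.

(** * A polytope with two simple slices *)

(** A polyhedron is a formulation of itself; the empty block accounts for the
    zero additional variables. *)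
Lemma bounded_solutions_formulation (R : realType) (k n : nat)
    (A : 'M[R]_(k, n)) (b : 'cV[R]_k) (M : R) :
  (forall z, solutions A b z -> forall j, `|z j 0| <= M) ->
  @is_formulation R n 0 k (solutions A b) (row_mx A 0) b.
Proof.
move=> bdd.
have dropE (x : 'cV[R]_n) (y : 'cV[R]_0) :
    solutions (row_mx A 0) b (col_mx x y) = solutions A b x.
  by rewrite /solutions /= mul_row_col mul0mx addr0.
split.
  apply: (@bounded_solutions_polytope _ _ _ _ _ M) => z.
  rewrite -[z]vsubmxK dropE => Sz j.
  rewrite -(splitK j); case: (fintype.split j) => [i|[]//] /=.
  by rewrite col_mxEu; apply: bdd.
rewrite eqEsubset; split=> x; first by move=> Sx; exists 0; rewrite dropE.
by case=> y; rewrite dropE.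
Qed.

Section ChordPolytope.
Variables (R : realType) (r N : nat).
Implicit Types (v : 'cV[R]_(r + r).+1) (i : 'I_r) (l : 'I_N).

Definition x_of i : 'I_(r + r).+1 := lift ord_max (lshift r i).
Definition y_of i : 'I_(r + r).+1 := lift ord_max (rshift r i).

Definition point (X Y : 'I_r -> R) (t : R) : 'cV[R]_(r + r).+1 :=
  \col_s oapp (fun s' => match fintype.split s' with
                         | inl i => X i
                         | inr i => Y i
                         end) t (unlift ord_max s).

Lemma point_x X Y t i : point X Y t (x_of i) 0 = X i.
Proof. by rewrite mxE /x_of liftK /= (unsplitK (inl _)). Qed.

Lemma point_y X Y t i : point X Y t (y_of i) 0 = Y i.
Proof. by rewrite mxE /y_of liftK /= (unsplitK (inr _)). Qed.

Lemma point_t X Y t : point X Y t ord_max 0 = t.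
Proof. by rewrite mxE unlift_none. Qed.

Lemma coord_ind (Q : 'I_(r + r).+1 -> Prop) :
  (forall i, Q (x_of i)) -> (forall i, Q (y_of i)) -> Q ord_max ->
  forall s, Q s.
Proof.
move=> Qx Qy Qt s; case: (unliftP ord_max s) => [s' ->|-> //].
by rewrite -(splitK s'); case: (fintype.split s') => i; [apply: Qx | apply: Qy].
Qed.

(** The knots [a / N] cut the parabola [y = x ^+ 2] over the unit interval into
    [N] chords, and [chord_slope a * x - chord_offset a] is the [a]-th chord. *)
Definition knot (a : nat) : R := a%:R / N%:R.
Definition chord_slope (a : nat) : R := knot a + knot a.+1.
Definition chord_offset (a : nat) : R := knot a * knot a.+1.

(** At [t = 0] this is a product of [r] polygons, each bounded below by the
    [N] chords.  At [t = 1] the inequalities [x_i + t <= 1] flatten it to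
    [x = 0], and what is left of the cube is cut by [1 <= \sum_i y_i]. *)
Definition chord_polytope : set 'cV[R]_(r + r).+1 :=
  [set v | [/\ unit_cube v,
    forall i, v (x_of i) 0 + v ord_max 0 <= 1,
    forall i l, chord_slope l * v (x_of i) 0 - v (y_of i) 0 <= chord_offset l &
    v ord_max 0 <= \sum_i v (y_of i) 0]].

Definition chord_polytope_ineq : Type :=
  ('I_(r + r).+1 + 'I_(r + r).+1) + ('I_r + ('I_r * 'I_N + unit)).

Definition chord_polytope_row (c : chord_polytope_ineq) : 'rV[R]_(r + r).+1 :=
  match c with
  | inl (inl s) => - delta_mx 0 s
  | inl (inr s) => delta_mx 0 s
  | inr (inl i) => delta_mx 0 (x_of i) + delta_mx 0 ord_max
  | inr (inr (inl (i, l))) =>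
      chord_slope l *: delta_mx 0 (x_of i) - delta_mx 0 (y_of i)
  | inr (inr (inr _)) => delta_mx 0 ord_max - \sum_i delta_mx 0 (y_of i)
  end.

Definition chord_polytope_rhs (c : chord_polytope_ineq) : R :=
  match c with
  | inl (inl _) => 0
  | inl (inr _) => 1
  | inr (inl _) => 1
  | inr (inr (inl (_, l))) => chord_offset l
  | inr (inr (inr _)) => 0
  end.

Definition chord_polytope_mx : 'M[R]_(#|{: chord_polytope_ineq}|, (r + r).+1) :=
  \matrix_c chord_polytope_row (enum_val c).

Definition chord_polytope_col : 'cV[R]_#|{: chord_polytope_ineq}| :=
  \col_c chord_polytope_rhs (enum_val c).

Lemma card_chord_polytope_ineq :
  #|{: chord_polytope_ineq}| = (r * N + 5 * r + 3)%N.
Proof. by rewrite !card_sum card_prod card_unit !card_ord; lia. Qed.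

Lemma delta_mulmx v s : ((delta_mx 0 s : 'rV[R]_(r + r).+1) *m v) 0 0 = v s 0.
Proof. by rewrite -rowE mxE. Qed.

Lemma chord_polytope_solutions :
  chord_polytope = solutions chord_polytope_mx chord_polytope_col.
Proof.
have solE v : solutions chord_polytope_mx chord_polytope_col v <->
    forall c, (chord_polytope_row c *m v) 0 0 <= chord_polytope_rhs c.
  split=> [Sv c|Sv c].
    have := Sv (enum_rank c).
    by rewrite -row_mulmx_coef rowK [chord_polytope_col _ _]mxE !enum_rankK.
  by rewrite -row_mulmx_coef rowK [chord_polytope_col _ _]mxE; apply: Sv.
have addE (a b : 'rV[R]_(r + r).+1) v :
  ((a + b) *m v) 0 0 = (a *m v) 0 0 + (b *m v) 0 0 by rewrite mulmxDl mxE.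
have oppE (a : 'rV[R]_(r + r).+1) v : (- a *m v) 0 0 = - (a *m v) 0 0.
  by rewrite mulNmx mxE.
have scaleE (q : R) (a : 'rV[R]_(r + r).+1) v :
  (q *: a *m v) 0 0 = q * (a *m v) 0 0 by rewrite -scalemxAl mxE.
have sumE v :
    ((\sum_i delta_mx 0 (y_of i) : 'rV[R]_(r + r).+1) *m v) 0 0 =
    \sum_i v (y_of i) 0.
  by rewrite mulmx_suml summxE; apply: eq_bigr => i _; rewrite delta_mulmx.
have E := (addE, oppE, scaleE, sumE, delta_mulmx).
rewrite eqEsubset; split=> v.
  case=> cube xt chords yt; apply/solE.
  case=> [[s|s]|[i|[[i l]|u]]]; rewrite /= ?E //.
  - by rewrite oppr_le0; case/andP: (cube s).
  - by case/andP: (cube s).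
  - by rewrite subr_le0.
move/solE => Sv; split.
- move=> s; have := Sv (inl (inl s)); have := Sv (inl (inr s)).
  by rewrite /= ?E oppr_le0 => -> ->.
- by move=> i; have := Sv (inr (inl i)); rewrite /= ?E.
- by move=> i l; have := Sv (inr (inr (inl (i, l)))); rewrite /= ?E.
- by have := Sv (inr (inr (inr tt))); rewrite /= ?E subr_le0.
Qed.

Lemma chord_polytope_bounded v s : chord_polytope v -> `|v s 0| <= 1.
Proof.
by case=> cube _ _ _; have /andP[v0 v1] := cube s; rewrite ger0_norm.
Qed.

(** * The facets of the disjunctive hull *)

Hypothesis N_gt0 : (0 < N)%N.
Implicit Type j : {ffun 'I_r -> 'I_N}.

Let N0 : N%:R != 0 :> R. Proof. by rewrite pnatr_eq0 -lt0n. Qed.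

Lemma knot_ge0 a : 0 <= knot a.
Proof. by rewrite divr_ge0. Qed.

Lemma knot_le a b : (knot a <= knot b) = (a <= b)%N.
Proof. by rewrite ler_pM2r ?invr_gt0 ?ltr0n // ler_nat. Qed.

Lemma knot_le1 a : (a <= N)%N -> knot a <= 1.
Proof. by move=> aN; rewrite ler_pdivrMr ?ltr0n // mul1r ler_nat. Qed.

Lemma knot_inj : injective knot.
Proof.
by move=> a b e; apply/eqP; rewrite eqn_leq -!knot_le e lexx.
Qed.

(** The two sides differ by [(knot a - knot l) * (knot a - knot l.+1)], and no
    knot lies strictly between two consecutive ones. *)
Lemma knot_above_chord (a l : nat) :
  chord_slope l * knot a - knot a ^+ 2 <= chord_offset l.
Proof.
rewrite /chord_slope /chord_offset.
have [al|la] := leqP a l.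
  have h1 : knot a <= knot l by rewrite knot_le.
  have h2 : knot a <= knot l.+1 by rewrite knot_le leqW.
  by have := mulr_ge0 (_ : 0 <= knot l - knot a) (_ : 0 <= knot l.+1 - knot a);
    rewrite !subr_ge0 => /(_ h1 h2); lra.
have h1 : knot l <= knot a by rewrite knot_le ltnW.
have h2 : knot l.+1 <= knot a by rewrite knot_le.
by have := mulr_ge0 (_ : 0 <= knot a - knot l) (_ : 0 <= knot a - knot l.+1);
  rewrite !subr_ge0 => /(_ h1 h2); lra.
Qed.

Definition parabola_point (a : 'I_r -> nat) : 'cV[R]_(r + r).+1 :=
  point (fun i => knot (a i)) (fun i => knot (a i) ^+ 2) 0.

Definition simplex_point i : 'cV[R]_(r + r).+1 :=
  point (fun=> 0) (fun i' => (i' == i)%:R) 1.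

Lemma parabola_point_slice (a : 'I_r -> nat) :
  (forall i, (a i <= N)%N) -> last_slice chord_polytope 0 (parabola_point a).
Proof.
move=> aN; split; last by rewrite /= point_t.
have a01 i : 0 <= knot (a i) <= 1 by rewrite knot_ge0 knot_le1.
split.
- apply: coord_ind => [i|i|];
    rewrite ?point_x ?point_y ?point_t ?lexx ?ler01 //.
  by have /andP[? ?] := a01 i; rewrite exprn_ge0 ?exprn_ile1.
- by move=> i; rewrite point_x point_t addr0; case/andP: (a01 i).
- by move=> i l; rewrite point_x point_y knot_above_chord.
- rewrite point_t sumr_ge0 // => i _; rewrite point_y exprn_ge0 //.
  by case/andP: (a01 i).
Qed.

Lemma simplex_point_slice i : last_slice chord_polytope 1 (simplex_point i).
Proof.
split; last by rewrite /= point_t.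
split.
- apply: coord_ind => [i'|i'|];
    rewrite ?point_x ?point_y ?point_t ?lexx ?ler01 //.
  by case: eqP => _; rewrite ?lexx ?ler01.
- by move=> i'; rewrite point_x point_t add0r.
- move=> i' l; rewrite point_x point_y mulr0 sub0r.
  apply: (@le_trans _ _ 0); first by rewrite oppr_le0; case: eqP.
  by rewrite mulr_ge0 ?knot_ge0.
- rewrite point_t (bigD1 i) //= point_y eqxx lerDl sumr_ge0 // => i' _.
  by rewrite point_y; case: eqP.
Qed.

(** Choosing one chord for each pair [(x_i, y_i)] gives a facet.  At [t = 0] its
    inequality is the sum of the chosen chord inequalities; the coefficient of
    [t] is the one for which it becomes [1 <= \sum_i y_i] at [t = 1], where
    [x = 0]. *)
Definition facet_row j : 'rV[R]_(r + r).+1 :=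
  \sum_i (chord_slope (j i) *: delta_mx 0 (x_of i) - delta_mx 0 (y_of i))
  + (1 + \sum_i chord_offset (j i)) *: delta_mx 0 ord_max.

Definition facet_rhs j : R := \sum_i chord_offset (j i).

Lemma facet_rowE j v : (facet_row j *m v) 0 0 =
  \sum_i (chord_slope (j i) * v (x_of i) 0 - v (y_of i) 0)
  + (1 + \sum_i chord_offset (j i)) * v ord_max 0.
Proof.
rewrite mulmxDl mxE mulmx_suml summxE -scalemxAl [X in _ + X]mxE delta_mulmx.
congr (_ + _); apply: eq_bigr => i _.
by rewrite mulmxBl mxE [X in _ + X]mxE -scalemxAl [X in X + _]mxE !delta_mulmx.
Qed.

Lemma facet_valid j v :
  convex_hull (last_slice chord_polytope 0 `|` last_slice chord_polytope 1) v ->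
  (facet_row j *m v) 0 0 <= facet_rhs j.
Proof.
apply: convex_hull_halfspace => {}v; rewrite facet_rowE.
case=> -[[cube xt chords yt] /= t].
  by rewrite t mulr0 addr0 ler_sum.
have x0 i : v (x_of i) 0 = 0.
  have /andP[x0 _] := cube (x_of i); apply/eqP; rewrite eq_le x0 andbT.
  by have := xt i; rewrite t; lra.
rewrite t mulr1; under eq_bigr do rewrite x0 mulr0 sub0r.
by rewrite sumrN; move: yt; rewrite t /facet_rhs; lra.
Qed.

(** A vertex of the product of the chosen chords, its [r] neighbours in that
    product, and the [r] vertices of the simplex: [2 * r + 1] affinely
    independent points. *)
Definition facet_point j (s : 'I_(r + r).+1) : 'cV[R]_(r + r).+1 :=
  oapp (fun s' => match fintype.split s' with
                  | inl i => parabola_point (fun i' => j i' + (i' == i))%N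
                  | inr i => simplex_point i
                  end)
    (parabola_point (fun i' => j i')) (unlift ord_max s).

Lemma facet_point_x j i :
  facet_point j (x_of i) = parabola_point (fun i' => j i' + (i' == i))%N.
Proof. by rewrite /facet_point liftK /= (unsplitK (inl _)). Qed.

Lemma facet_point_y j i : facet_point j (y_of i) = simplex_point i.
Proof. by rewrite /facet_point liftK /= (unsplitK (inr _)). Qed.

Lemma facet_point_t j : facet_point j ord_max = parabola_point (fun i' => j i').
Proof. by rewrite /facet_point unlift_none. Qed.

Lemma facet_point_hull j s :
  convex_hull (last_slice chord_polytope 0 `|` last_slice chord_polytope 1)
    (facet_point j s).
Proof.
apply: sub_gen_smallest; move: s; apply: coord_ind => [i|i|].
- rewrite facet_point_x; left; apply: parabola_point_slice => i'.
  by have := ltn_ord (j i'); case: eqP => _ /=; lia.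
- by rewrite facet_point_y; right; apply: simplex_point_slice.
- by rewrite facet_point_t; left; apply: parabola_point_slice => i; apply: ltnW.
Qed.

Lemma facet_row_parabola j (a : 'I_r -> nat) :
  (facet_row j *m parabola_point a) 0 0 =
  \sum_i (chord_slope (j i) * knot (a i) - knot (a i) ^+ 2).
Proof.
rewrite facet_rowE point_t mulr0 addr0.
by apply: eq_bigr => i _; rewrite point_x point_y.
Qed.

Lemma facet_tight j s : (facet_row j *m facet_point j s) 0 0 = facet_rhs j.
Proof.
move: s; apply: coord_ind => [i|i|].
- rewrite facet_point_x facet_row_parabola; apply: eq_bigr => i' _.
  rewrite /chord_slope /chord_offset.
  by case: eqP => _ /=; rewrite ?addn1 ?addn0; ring.
- rewrite facet_point_y facet_rowE point_t mulr1 /facet_rhs addrA.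
  rewrite [X in X + _](_ : _ = 0) ?add0r //.
  rewrite (bigD1 i) //= point_x point_y eqxx mulr0 big1 ?addr0 ?add0r ?addNr //.
  by move=> i' /negPf ni; rewrite point_x point_y ni mulr0 subr0.
- rewrite facet_point_t facet_row_parabola; apply: eq_bigr => i _.
  by rewrite /chord_slope /chord_offset; ring.
Qed.

Lemma knot_step a : knot a.+1 - knot a = N%:R^-1.
Proof. by rewrite /knot -mulrBl -natrB // subSnn mul1r. Qed.

Lemma facet_points_free j :
  row_free (\matrix_(s < r + r)
    (facet_point j (lift ord_max s) - facet_point j ord_max)^T).
Proof.
apply: inj_row_free => u uM.
have comb c : \sum_i u 0 (lshift r i) *
      (parabola_point (fun i' => j i' + (i' == i))%N c 0
       - parabola_point (fun i' => j i') c 0)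
    + \sum_i u 0 (rshift r i) *
      (simplex_point i c 0 - parabola_point (fun i' => j i') c 0) = 0.
  have entry s : (facet_point j s - facet_point j ord_max) c 0 =
      facet_point j s c 0 - facet_point j ord_max c 0.
    by rewrite [LHS]mxE [X in _ + X]mxE.
  have := congr1 (fun a : 'rV_ _ => a 0 c) uM.
  rewrite /= [RHS]mxE [X in X = _ -> _]mxE big_split_ord /= => uc.
  rewrite -[RHS]uc.
  congr (_ + _); apply: eq_bigr => i _; congr (_ * _);
    rewrite [RHS]mxE [RHS]mxE entry facet_point_t.
    by rewrite -facet_point_x.
  by rewrite -(facet_point_y j).
have sum0 : \sum_i u 0 (rshift r i) = 0.
  have := comb ord_max; rewrite big1 ?add0r => [|i _]; last first.
    by rewrite !point_t subrr mulr0.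
  by under eq_bigr do rewrite !point_t subr0 mulr1.
have ux i : u 0 (lshift r i) = 0.
  have := comb (x_of i); under [X in _ + X]eq_bigr do rewrite !point_x sub0r.
  rewrite -mulr_suml sum0 mul0r addr0 (bigD1 i) //=.
  rewrite !point_x eqxx addn1 knot_step.
  rewrite big1 => [|i' ni]; last first.
    by rewrite !point_x eq_sym (negPf ni) addn0 subrr mulr0.
  by rewrite addr0 => /eqP; rewrite mulf_eq0 invr_eq0 (negPf N0) orbF => /eqP.
have uy i : u 0 (rshift r i) = 0.
  have := comb (y_of i); rewrite big1 => [|i' _]; last by rewrite ux mul0r.
  under eq_bigr do rewrite !point_y mulrBr.
  rewrite add0r sumrB -mulr_suml sum0 mul0r subr0 (bigD1 i) //= eqxx mulr1.
  by rewrite big1 ?addr0 // => i' ni; rewrite eq_sym (negPf ni) mulr0.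
apply/rowP => s; rewrite [RHS]mxE -(splitK s).
by case: (fintype.split s) => i; [apply: ux | apply: uy].
Qed.

(** Along the [j' i]-th chord, the [i]-th term of the inequality of [j] changes
    by the difference of the two slopes times the width of the chord. *)
Lemma facet_separated j j' : j != j' ->
  exists s, (facet_row j *m facet_point j' s) 0 0 !=
            (facet_row j *m facet_point j' ord_max) 0 0.
Proof.
move=> jj'; have [i ji] : exists i, j i != j' i.
  apply: contrapT => nji; move/eqP: jj'; apply; apply/ffunP => i.
  by apply/eqP; apply: contrapT => /negP ji; apply: nji; exists i.
exists (x_of i); rewrite facet_point_x facet_point_t !facet_row_parabola.
rewrite (bigD1 i) //= eqxx addn1 [X in _ != X](bigD1 i) //=.
rewrite [X in _ + X](eq_bigr (fun i' =>
    chord_slope (j i') * knot (j' i') - knot (j' i') ^+ 2)); last first.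
  by move=> i' /negPf ->; rewrite addn0.
rewrite -subr_eq0 /chord_slope.
have -> : forall S : R, (knot (j i) + knot (j i).+1) * knot (j' i).+1
      - knot (j' i).+1 ^+ 2 + S
      - ((knot (j i) + knot (j i).+1) * knot (j' i) - knot (j' i) ^+ 2 + S) =
    ((knot (j i).+1 - knot (j i)) - (knot (j' i).+1 - knot (j' i))
      + (knot (j i) - knot (j' i)) *+ 2) * (knot (j' i).+1 - knot (j' i)).
  by move=> S; ring.
rewrite !knot_step subrr add0r mulf_neq0 ?invr_eq0 // mulrn_eq0 /= subr_eq0.
by apply: contra ji => /eqP/knot_inj/val_inj ->.
Qed.

Lemma chord_polytope_hull_size (k m : nat) (A : 'M[R]_(k, (r + r).+1 + m))
    (b : 'cV[R]_k) :
  is_formulation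
    (convex_hull (last_slice chord_polytope 0 `|` last_slice chord_polytope 1))
    A b ->
  (N ^ r <= k.+1 ^ m.+1)%N.
Proof.
case=> _ /facet_count /(_ facet_valid facet_point_hull facet_tight
  facet_points_free facet_separated).
by rewrite card_ffun !card_ord.
Qed.

End ChordPolytope.

(** * Counting *)

Lemma horner_growth (R : realType) (sigma : {poly R}) :
  exists C : nat, forall x : R, 1 <= x ->
    sigma.[x] + 1 <= C%:R * x ^+ size sigma.
Proof.
pose S := \sum_(i < size sigma) `|sigma`_i|.
have S1 : 0 <= S + 1 by rewrite addr_ge0 ?sumr_ge0.
exists (Num.bound (S + 1)) => x x1.
have x0 : 0 <= x by apply: le_trans x1.
have xn : 1 <= x ^+ size sigma by rewrite exprn_ege1.
apply: (@le_trans _ _ ((S + 1) * x ^+ size sigma)); last first.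
  by rewrite ler_wpM2r ?exprn_ge0 // ltW // archi_boundP.
rewrite mulrDl mul1r lerD // horner_coef mulr_suml ler_sum // => i _.
apply: (@le_trans _ _ (`|sigma`_i| * x ^+ i)).
  by rewrite ler_wpM2r ?exprn_ge0 ?ler_norm.
by rewrite ler_wpM2l // ler_weXn2l // ltnW.
Qed.

Theorem theorem20 (R : realType) (sigma : {poly R}) :
  exists (c : R) (d0 : nat), 0 < c /\
  forall n : nat, odd n.+1 ->
  exists (P : set 'cV[R]_n.+1) (f m0 : nat)
         (A0 : 'M[R]_(f, n.+1 + m0)) (b0 : 'cV[R]_f),
    [/\ polytope P, P !=set0, P `<=` @unit_cube R n.+1,
        is_formulation P A0 b0 &
        forall (k m : nat) (A : 'M[R]_(k, n.+1 + m)) (b : 'cV[R]_k),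
          is_formulation
            (convex_hull (last_slice P 0 `|` last_slice P 1)) A b ->
          k%:R <= sigma.[f%:R] ->
          (d0 <= n.+1)%N ->
          c * n.+1%:R <= m%:R].
Proof.
have [C growth] := horner_growth sigma.
pose E := (size sigma).*2.+1.
exists (6 * E)%:R^-1, (4 * E).+1; split; first by rewrite invr_gt0 ltr0n.
move=> n n_odd; have /negPf n_even : ~~ odd n by [].
have [r ->] : exists r, n = (r + r)%N.
  by exists n./2; rewrite addnn -[LHS]odd_double_half n_even.
(* With N knots, the size r * N + 5 * r + 3 of the formulation is at most N ^ 2;
   adding C to N absorbs the constant factor of the polynomial bound. *)
pose N := (r + 5 + C)%N.
have N_gt0 : (0 < N)%N by rewrite /N; lia.
have bdd z : solutions (chord_polytope_mx R r N) (chord_polytope_col R r N) z ->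
    forall s, `|z s 0| <= 1.
  rewrite -chord_polytope_solutions => Pz s.
  exact: chord_polytope_bounded Pz.
exists (chord_polytope N), #|{: chord_polytope_ineq r N}|, 0.
exists (row_mx (chord_polytope_mx R r N) 0), (chord_polytope_col R r N); split.
- by rewrite chord_polytope_solutions; apply: bounded_solutions_polytope bdd.
- exists (parabola_point R N (fun=> 0)).
  by have [] := parabola_point_slice R N_gt0 (fun _ : 'I_r => leq0n N).
- by move=> v [].
- by rewrite [in X in is_formulation X]chord_polytope_solutions;
    apply: bounded_solutions_formulation bdd.
move=> k m A b /(chord_polytope_hull_size N_gt0) hull k_le d_ge.
have f_le : (#|{: chord_polytope_ineq r N}| <= N ^ 2)%N.
  by rewrite card_chord_polytope_ineq /N; nia.
have k_lt : (k.+1 <= N ^ E)%N.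
  have f_ge1 : 1 <= #|{: chord_polytope_ineq r N}|%:R :> R.
    by rewrite ler1n card_chord_polytope_ineq addn3.
  have : (k.+1 <= C * #|{: chord_polytope_ineq r N}| ^ size sigma)%N.
    rewrite -(ler_nat R) natrM natrX -natr1.
    by apply: le_trans (growth _ f_ge1); rewrite lerD2r.
  move=> /leq_trans; apply; rewrite expnS leq_mul //; first by rewrite /N; lia.
  by rewrite -mul2n expnM; case: (size sigma) => [//|D]; rewrite leq_exp2r.
have : (r <= E * m.+1)%N.
  have N_gt1 : (1 < N)%N by rewrite /N; lia.
  rewrite -(leq_exp2l _ _ N_gt1) (leq_trans hull) // expnM.
  by rewrite leq_exp2r.
move=> r_le; rewrite mulrC ler_pdivrMr ?ltr0n // -natrM ler_nat.
have E_gt0 : (0 < E)%N by [].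
by move: d_ge r_le E_gt0; rewrite mulnS; generalize E => e; nia.
Qed.
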